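(* A topological space is $M$-metrizable for some atom-free MVS $M$ if and only if it can be topologically embedded into a space $(Y,\mathcal{T}_{\mathcal{U}})$, where $(Y,\mathcal{U})$ is a quasiuniform space, $\mathcal{T}_{\mathcal{U}}$ is the topology induced by $\mathcal{U}$, and there exist a set $U_0\subset Y\times Y$ containing the diagonal $\{(y,y):y\in Y\}$ and a base $\mathcal{V}^{*}$ of $\mathcal{U}$ with $U_0\subsetneq U$ for all $U\in\mathcal{V}^{*}$ and $\bigcup\mathcal{V}^{*}=Y\times Y$, satisfying conditions (Q1)--(Q4) below, where for $x,y\in Y$ $$U_{x,y}=\bigcap\{U\in\mathcal{V}^{*}:(x,y)\in U\}\ \text{ if }(x,y)\notin U_0,\qquad U_{x,y}=U_0\ \text{ if }(x,y)\in U_0.$$ (Q1) $\mathcal{V}^{*}=\{U_{x,y}:(x,y)\in (Y\times Y)\setminus U_0\}$. (Q2) Let $\mathcal{V}=\mathcal{V}^{*}\cup\{U_0\}$ and for $U,V\in\mathcal{V}$ let $U+V$ be the intersection of all sets $W\in\mathcal{V}$ such that $V\circ U\subset W$. Then $\mathcal{V}$ is closed under the operation $+$, and $(\mathcal{V},+)$ is an MVS with neutral element $U_0$. (Q3) For the relation $\unlhd$ on $\mathcal{V}$ induced by $+$ (that is, $U\unlhd V$ iff $U+W=V$ for some $W\in\mathcal{V}$), and all $U,V\in\mathcal{V}$: $U\unlhd V$ if and only if $U\subset V$. (Q4) The MVS $(\mathcal{V},+)$ is atom-free.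
   Context: A metric value set (MVS) is a set $M$ with at least two elements and a binary operation $+$ such that: (M1) $+$ is associative; (M2) $+$ has a (two-sided) neutral element $e$, and we write $M^{*}=M\setminus\{e\}$; (M3) if $m_1+m_2=e$ then $m_1=m_2=e$; (M4) for all $m_1,m_2\in M^{*}$ there are $m_3\in M^{*}$ and $m_4,m_5\in M$ with $m_1=m_3+m_4$ and $m_2=m_3+m_5$. For $m_1,m_2\in M$ write $m_1\unlhd m_2$ if $m_1+m_3=m_2$ for some $m_3\in M$, and $m_1\lhd m_2$ if $m_1+m_3=m_2$ for some $m_3\in M^{*}$ (so $m\lhd m$ is possible). $M$ is atom-free if $+$ is commutative and for every $m\in M^{*}$ there is $n\in M^{*}$ with $n\lhd m$. A quasimetric function is a map $f\colon X\times X\to M$ with $f(x,x)=e$ for all $x\in X$ and $f(x,z)\unlhd f(x,y)+f(y,z)$ for all $x,y,z\in X$ (no symmetry is required). It induces the topology $\mathcal{T}_f$ on $X$ in which, for every $x\in X$, the balls $B_f(x,m)=\{y\in X: f(x,y)\lhd m\}$, $m\in M^{*}$, form an open neighbourhood base at $x$. A topological space $(X,\mathcal{T})$ is $M$-metrizable if $\mathcal{T}=\mathcal{T}_f$ for some quasimetric function $f\colon X\times X\to M$. For $A,B\subset Y\times Y$, $A\circ B$ is the set of $(x,z)$ for which there is $y\in Y$ with $(x,y)\in B$ and $(y,z)\in A$. A quasiuniformity on $Y$ is a non-empty family $\mathcal{U}$ of subsets of $Y\times Y$, each containing the diagonal, closed under supersets in $Y\times Y$ and under pairwise intersections, and such that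 for each $U\in\mathcal{U}$ there is $V\in\mathcal{U}$ with $V\circ V\subset U$; then $(Y,\mathcal{U})$ is a quasiuniform space. A base of $\mathcal{U}$ is a subfamily $\mathcal{B}\subset\mathcal{U}$ such that every $U\in\mathcal{U}$ contains some member of $\mathcal{B}$. The topology induced by $\mathcal{U}$ (equivalently by any base $\mathcal{B}$) is the one for which, for each $x\in Y$, the sets $U[x]=\{y\in Y:(x,y)\in U\}$, $U\in\mathcal{B}$, form a (not necessarily open) neighbourhood base at $x$. A topological embedding is a map that is a homeomorphism onto its image with the relative topology. *)

(* Defs.v *)
From mathcomp Require Import all_boot.
From mathcomp Require Import all_classical topology.

Set Implicit Arguments.
Unset Strict Implicit.
Unset Printing Implicit Defensive.

Local Open Scope classical_set_scope.
Local Open Scope relation_scope.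

(* An algebraic structure is given by a carrier set [M] inside an ambient type
   [T] and a function [add] on [T] of which only the values on [M] matter: the
   value set of a metric and a family of relations on a space are then treated
   by the same definitions. *)

(* [mvs_closed] says that [add] restricts to a binary operation on [M]; the
   neutral element is unique, so it can be a parameter. *)
Record is_mvs (T : Type) (M : set T) (add : T -> T -> T) (e : T) : Prop := {
  mvs_two : exists a b, [/\ M a, M b & a <> b];
  mvs_closed : forall a b, M a -> M b -> M (add a b);
  mvs_assoc : forall a b c, M a -> M b -> M c ->
    add a (add b c) = add (add a b) c;
  mvs_neutral_in : M e;
  mvs_neutral : forall a, M a -> add e a = a /\ add a e = a;
  mvs_conical : forall a b, M a -> M b -> add a b = e -> a = e /\ b = e;
  mvs_lower : forall a b, (M `\ e) a -> (M `\ e) b ->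
    exists c a' b', [/\ (M `\ e) c, M a', M b', a = add c a' & b = add c b']
}.

Definition mvs_le (T : Type) (M : set T) (add : T -> T -> T) (a b : T) : Prop :=
  exists2 c, M c & add a c = b.

Definition mvs_lt (T : Type) (M : set T) (add : T -> T -> T) (e a b : T) : Prop :=
  exists2 c, (M `\ e) c & add a c = b.

Definition atom_free (T : Type) (M : set T) (add : T -> T -> T) (e : T) : Prop :=
  (forall a b, M a -> M b -> add a b = add b a) /\
  (forall a, (M `\ e) a -> exists2 b, (M `\ e) b & mvs_lt M add e b a).

Record is_quasimetric (X T : Type) (M : set T) (add : T -> T -> T) (e : T)
    (f : X -> X -> T) : Prop := {
  qm_val : forall x y, M (f x y);
  qm_refl : forall x, f x x = e;
  qm_triangle : forall x y z, mvs_le M add (f x z) (add (f x y) (f y z))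
}.

Definition qball (X T : Type) (M : set T) (add : T -> T -> T) (e : T)
    (f : X -> X -> T) (x : X) (m : T) : set X :=
  [set y | mvs_lt M add e (f x y) m].

(* The topology of [X] is the one induced by [f]; a topology is determined by
   its neighbourhood filters, and [filter_from] is the filter with the given
   base. *)
Definition induced_by_quasimetric (X : topologicalType) (T : Type) (M : set T)
    (add : T -> T -> T) (e : T) (f : X -> X -> T) : Prop :=
  forall x : X,
    (forall m, (M `\ e) m -> open_nbhs x (qball M add e f x m)) /\
    nbhs x = filter_from (M `\ e) (qball M add e f x).

Definition mvs_metrizable (X : topologicalType) (T : Type) (M : set T)
    (add : T -> T -> T) (e : T) : Prop :=
  exists2 f : X -> X -> T,
    is_quasimetric M add e f & induced_by_quasimetric M add e f.

(* [V \; U] is the set of the (x, z) such that (x, y) is in [U] and (y, z) is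
   in [V] for some y. *)
Record is_quasiuniformity (Y : Type) (E : set (set (Y * Y))) : Prop := {
  qu_nonempty : E !=set0;
  qu_diag : forall U, E U -> diagonal `<=` U;
  qu_super : forall U V, E U -> U `<=` V -> E V;
  qu_inter : forall U V, E U -> E V -> E (U `&` V);
  qu_split : forall U, E U -> exists2 V, E V & V \; V `<=` U
}.

Definition is_qu_base (Y : Type) (E B : set (set (Y * Y))) : Prop :=
  B `<=` E /\ forall U, E U -> exists2 V, B V & V `<=` U.

(* [xsection U x] is the set U[x] of the y with (x, y) in [U]. *)
Definition induced_by_quasiuniformity (Y : topologicalType)
    (E : set (set (Y * Y))) : Prop :=
  forall x : Y, nbhs x = filter_from E (fun U => xsection U x).

(* The last condition is the continuity of the inverse on [range f] with its
   relative topology. *)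
Definition topological_embedding (X Y : topologicalType) (f : X -> Y) : Prop :=
  [/\ injective f, continuous f &
      forall O : set X, open O -> open (f @` O : set (subspace (range f)))].

(* The set U_{x,y} for p = (x, y). *)
Definition least_entourage (Y : Type) (U0 : set (Y * Y))
    (Vs : set (set (Y * Y))) (p : Y * Y) : set (Y * Y) :=
  if p \in U0 then U0 else \bigcap_(U in [set U | Vs U /\ U p]) U.

Definition entourage_add (Y : Type) (V : set (set (Y * Y)))
    (A B : set (Y * Y)) : set (Y * Y) :=
  \bigcap_(W in [set W | V W /\ B \; A `<=` W]) W.

(* Main.v *)
Require Import Defs.
From HB Require Import structures.
From mathcomp Require Import all_boot.
From mathcomp Require Import all_classical topology.

Set Implicit Arguments.
Unset Strict Implicit.
Unset Printing Implicit Defensive.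

Local Open Scope classical_set_scope.

(** Both sides of the equivalence speak of the same neighbourhoods. For a
    quasimetric [d] on [Y] with values in an atom-free MVS [M], let
    [level m = {(x, y) | d x y <= m}], where [<=] is the order of [M]. Because
    [M] is atom-free, the sets [level m] with [m <> e] form a base of a
    quasiuniformity whose topology is the one of the balls
    ([filter_from_qball], [sublevel_quasiuniformity]).

    From a metric to a quasiuniformity. The triangle inequality gives
    [level n o level m <= level (m + n)]. If [d] realizes every sum, in the
    sense that for all [m], [n] some [x], [y], [z] satisfy [d x y = m],
    [d y z = n] and [d x z = m + n], then [level (m + n)] is the least level
    set with this property, and inclusion of level sets is exactly the order of
    [M]. Hence [m |-> level m] carries the addition, the order and the MVS
    axioms of [M] to the family of level sets
    ([sublevel_conditions]). The order of [M] may fail to be antisymmetric, in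
    which case several values share a level set; all axioms survive this
    identification since [e] is only identified with itself
    ([mvs_image], [atom_free_image]).

    A given quasimetric [f] need not realize every sum, so its space is first
    enlarged. To each point [x] are attached two spines for every value [t],
    whose tips lie at distance [t] from [x] in both directions; a path between
    two tips runs down one spine, across by [f] and up the other. This extends
    [f] to a quasimetric, and two spines at the same point realize every sum
    ([hedgehog_quasimetric], [hedgehog_realizes_sums]).

    From a quasiuniformity to a metric. The map [(x, y) |-> U_{x,y}] is itself
    a quasimetric with values in the family of entourages: their order is
    inclusion, and [U_{x,z}] lies in [U_{x,y} + U_{y,z}] because the latter is
    a member of the family containing [(x, z)]. Its closed balls are the
    sections of the entourages ([embeds_metrizable]). *)

(** * Level sets and hedgehogs *)

Definition sublevel (X T : Type) (M : set T) (add : T -> T -> T)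
    (f : X -> X -> T) (m : T) : set (X * X) :=
  [set p | mvs_le M add (f p.1 p.2) m].

(** This is what makes the composition of two level sets determine the sum of
    their values; with [n] the neutral element it also makes [d] onto. *)
Definition realizes_sums (Y T : Type) (M : set T) (add : T -> T -> T)
    (d : Y -> Y -> T) : Prop :=
  forall m n, M m -> M n ->
    exists x y z, [/\ d x y = m, d y z = n & d x z = add m n].

(** [(x, t, i)] is the tip of the [i]-th spine of length [t] at [x]. *)
Definition hedgehog (T : Type) (M : set T) (Z : Type) : Type :=
  (Z * {t | M t} * bool)%type.

Definition hedgehog_dist (T : Type) (M : set T) (add : T -> T -> T) (e : T)
    (Z : Type) (f : Z -> Z -> T) (p q : hedgehog M Z) : T :=
  if `[< p = q >] then e
  else add (add (sval p.1.2) (f p.1.1 q.1.1)) (sval q.1.2).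

(** * Order of a metric value set *)

Section MetricValueSet.
Context {T : Type} {M : set T} {add : T -> T -> T} {e : T}.
Hypothesis mvsM : is_mvs M add e.

Local Notation le := (mvs_le M add).
Local Notation lt := (mvs_lt M add e).

Lemma mvs_e : M e. Proof. exact: mvs_neutral_in mvsM. Qed.

Lemma mvs_add a b : M a -> M b -> M (add a b).
Proof. exact: (mvs_closed mvsM). Qed.

Lemma mvs_add0 a : M a -> add e a = a.
Proof. by move=> /(mvs_neutral mvsM)[]. Qed.

Lemma mvs_addr0 a : M a -> add a e = a.
Proof. by move=> /(mvs_neutral mvsM)[]. Qed.

Lemma mvs_le_refl a : M a -> le a a.
Proof. by move=> Ma; exists e; [exact: mvs_e | exact: mvs_addr0]. Qed.

Lemma mvs_le_trans a b c : M a -> le a b -> le b c -> le a c.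
Proof.
move=> Ma [x Mx <-] [y My <-]; exists (add x y); first exact: mvs_add.
exact: (mvs_assoc mvsM Ma Mx My).
Qed.

Lemma mvs_le_addr a b : M b -> le a (add a b).
Proof. by exists b. Qed.

Lemma mvs_le_e a : M a -> le a e -> a = e.
Proof. by move=> Ma [b Mb] /(mvs_conical mvsM Ma Mb)[]. Qed.

Lemma mvs_add_nonneutral a b : M a -> (M `\ e) b -> (M `\ e) (add a b).
Proof.
move=> Ma [Mb be]; split; first exact: mvs_add.
by move=> /(mvs_conical mvsM Ma Mb)[].
Qed.

Lemma mvs_ltW a b : lt a b -> le a b.
Proof. by move=> [c [Mc _] <-]; exists c. Qed.

Lemma mvs_le_lt_trans a b c : M a -> le a b -> lt b c -> lt a c.
Proof.
move=> Ma [x Mx <-] [y My <-]; exists (add x y).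
  exact: mvs_add_nonneutral.
by apply: (mvs_assoc mvsM Ma Mx); case: My.
Qed.

Section Commutative.
Hypothesis addC : forall a b, M a -> M b -> add a b = add b a.

Lemma mvs_le_addl a b : M a -> M b -> le a (add b a).
Proof. by move=> Ma Mb; rewrite addC//; exact: mvs_le_addr. Qed.

Lemma mvs_le_add a b c d : M a -> M c -> le a b -> le c d ->
  le (add a c) (add b d).
Proof.
move=> Ma Mc [x Mx <-] [y My <-]; exists (add x y); first exact: mvs_add.
have assoc := mvs_assoc mvsM; have addM := mvs_add.
have Mxy := addM _ _ Mx My; have Mcy := addM _ _ Mc My.
rewrite -(assoc _ _ _ Ma Mc Mxy) (assoc _ _ _ Mc Mx My) (addC Mc Mx).
by rewrite -(assoc _ _ _ Mx Mc My) (assoc _ _ _ Ma Mx Mcy).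
Qed.

End Commutative.

(** * Topology of a quasimetric *)

(** An open ball lies in the closed one of the same radius. It contains the
    closed one of radius [n] as soon as [n < m], and atom-freeness provides
    such an [n]. *)
Lemma filter_from_qball {X : Type} (f : X -> X -> T) x :
  atom_free M add e -> is_quasimetric M add e f ->
  filter_from (M `\ e) (qball M add e f x) =
  filter_from (M `\ e) (fun m => xsection (sublevel M add f m) x).
Proof.
move=> [_ af] qf; apply/seteqP; split=> A [m Mm mA].
  have [n Mn nm] := af _ Mm; exists n => // y /xsectionP /= xy.
  apply: mA; apply: (mvs_le_lt_trans _ xy nm); exact: (qm_val qf).
exists m => // y xy; apply: mA; apply/xsectionP; exact: mvs_ltW.
Qed.

(** Balls are automatically open: if [f x y + k = m] with [k <> e], the
    triangle inequality puts the ball of radius [k] at [y] inside the ball of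
    radius [m] at [x]. *)
Lemma induced_by_quasimetric_nbhs {X : topologicalType} (f : X -> X -> T) :
  is_quasimetric M add e f ->
  (forall x : X, nbhs x = filter_from (M `\ e) (qball M add e f x)) ->
  induced_by_quasimetric M add e f.
Proof.
move=> qf nbhsf x; split=> // m [Mm me].
have Mf y z : M (f y z) by exact: (qm_val qf).
split; last first.
  by exists m => //; rewrite (qm_refl qf) mvs_add0.
rewrite openE => y [k [Mk ke] km]; rewrite /interior nbhsf.
exists k => // z [l Ml lk] /=.
have := qm_triangle qf x y z => /(@mvs_le_lt_trans _ _ m); apply=> //.
exists l => //; rewrite -(mvs_assoc mvsM) ?lk//.
by case: Ml.
Qed.

(** * Images of a metric value set *)

(** The trivial kernel, which is weaker than injectivity, is what the
    axioms mentioning non-neutral elements require of the image; the others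
    pass to any additive image. *)
Lemma mvs_image {S : Type} (phi : T -> S) (addS : S -> S -> S) :
  (forall a b, M a -> M b -> addS (phi a) (phi b) = phi (add a b)) ->
  (forall a, M a -> phi a = phi e -> a = e) ->
  is_mvs (phi @` M) addS (phi e).
Proof.
move=> phiD ker; have Me := mvs_e; have MD := mvs_add.
have nz a : M a -> a <> e -> (phi @` M `\ phi e) (phi a).
  by move=> Ma ae; split; [exists a | move/(ker _ Ma)].
split.
- have [a [b [Ma Mb ab]]] := mvs_two mvsM.
  have [c Mc ce] : exists2 c, M c & c <> e.
    have [ae|ae] := EM (a = e); last by exists a.
    by exists b => // be; apply: ab; rewrite ae be.
  exists (phi c), (phi e); split; [by exists c | by exists e | ].
  by move/(ker _ Mc).
- move=> _ _ [a Ma <-] [b Mb <-]; rewrite phiD//.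
  by exists (add a b) => //; exact: MD.
- move=> _ _ _ [a Ma <-] [b Mb <-] [c Mc <-].
  by rewrite !phiD ?(mvs_assoc mvsM)//; exact: MD.
- by exists e.
- by move=> _ [a Ma <-]; rewrite !phiD// mvs_add0// mvs_addr0.
- move=> _ _ [a Ma <-] [b Mb <-]; rewrite phiD// => /ker.
  by move=> /(_ (MD _ _ Ma Mb)) /(mvs_conical mvsM Ma Mb)[-> ->].
- move=> _ _ [[a Ma <-] ae] [[b Mb <-] be].
  have [||c [a' [b' [[Mc ce] Ma' Mb' -> ->]]]] := @mvs_lower _ _ _ _ mvsM a b.
    by split=> // /= ae'; apply: ae; rewrite ae'.
    by split=> // /= be'; apply: be; rewrite be'.
  exists (phi c), (phi a'), (phi b'); rewrite !phiD//.
  by split=> //; exact: nz.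
Qed.

Lemma atom_free_image {S : Type} (phi : T -> S) (addS : S -> S -> S) :
  (forall a b, M a -> M b -> addS (phi a) (phi b) = phi (add a b)) ->
  (forall a, M a -> phi a = phi e -> a = e) ->
  atom_free M add e -> atom_free (phi @` M) addS (phi e).
Proof.
move=> phiD ker [addC af].
have nz a : (M `\ e) a -> (phi @` M `\ phi e) (phi a).
  by move=> [Ma ae]; split; [exists a | move/(ker _ Ma)].
split=> [_ _ [a Ma <-] [b Mb <-]|_ [[a Ma <-] ae]].
  by rewrite !phiD// addC.
have [|b Mb [c Mc bc]] := af a.
  by split=> // /= ae'; apply: ae; rewrite ae'.
exists (phi b); first exact: nz.
exists (phi c); first exact: nz.
by rewrite phiD ?bc//; [case: Mb | case: Mc].
Qed.

(** * The quasiuniformity of level sets *)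

Section Sublevels.
Context {Y : Type} (d : Y -> Y -> T).
Local Notation level := (sublevel M add d).
Hypotheses (afM : atom_free M add e) (qd : is_quasimetric M add e d).

Let addC := afM.1.
Let Md x y : M (d x y). Proof. exact: (qm_val qd). Qed.

Lemma sublevel_mono m n : le m n -> level m `<=` level n.
Proof. by move=> mn p pm; exact: mvs_le_trans pm mn. Qed.

Lemma diagonal_sublevel m : M m -> diagonal `<=` level m.
Proof.
move=> Mm [x y] /diagonalP /= ->; rewrite /sublevel/= (qm_refl qd).
by exists m => //; rewrite mvs_add0.
Qed.

(** In [V \; U] a pair is first moved along [U], so [level m] and [level n]
    occur in the opposite order to [m + n]. *)
Lemma sublevel_comp m n : M m -> M n ->
  (level n \; level m)%relation `<=` level (add m n).
Proof.
move=> Mm Mn [x z] [y /= xy yz].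
apply: (mvs_le_trans _ (qm_triangle qd x y z)) => //.
by apply: mvs_le_add.
Qed.

(** Two non-neutral radii have a non-neutral lower bound, hence intersections.
    Splitting [m = b + c] by atom-freeness and taking such a bound [k] of [b]
    and [c] yields [k + k <= m], hence the halving axiom. *)
Lemma sublevel_quasiuniformity :
  is_quasiuniformity (filter_from (M `\ e) level).
Proof.
have [a [b [Ma Mb ab]]] := mvs_two mvsM.
split.
- exists setT; have [ae|ae] := EM (a = e); last by exists a.
  by exists b => //; split=> // be; apply: ab; rewrite ae be.
- move=> U [m [Mm _]] mU; apply: subset_trans mU; exact: diagonal_sublevel.
- by move=> U V [m Mm mU] UV; exists m => //; exact: subset_trans mU UV.
- move=> U V [m Mm mU] [n Mn nV].
  have [c [m' [n' [Mc Mm' Mn' mE nE]]]] := mvs_lower mvsM Mm Mn.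
  exists c => //; rewrite subsetI; split.
    by apply: subset_trans mU; apply: sublevel_mono; rewrite mE; exists m'.
  by apply: subset_trans nV; apply: sublevel_mono; rewrite nE; exists n'.
- move=> U [m Mm mU].
  have [b' Mb' [c Mc bc]] := afM.2 _ Mm.
  have [k [b'' [c' [Mk Mb'' Mc' bE cE]]]] := mvs_lower mvsM Mb' Mc.
  have [Mk0 _] := Mk.
  exists (level k); first exact: in_filter_from.
  apply: subset_trans mU; apply: subset_trans (sublevel_comp Mk0 Mk0) _.
  apply: sublevel_mono; rewrite -bc.
  by apply: mvs_le_add => //; [rewrite bE; exists b'' | rewrite cE; exists c'].
Qed.

Hypothesis sumsd : realizes_sums M add d.

Lemma sublevel_onto m : M m -> exists p, d p.1 p.2 = m.
Proof.
by move=> Mm; have [x [y [_ [xy _ _]]]] := sumsd Mm Mm; exists (x, y).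
Qed.

Lemma sublevel_subset m n : M m -> level m `<=` level n <-> le m n.
Proof.
move=> Mm; split; last exact: sublevel_mono.
have [p <-] := sublevel_onto Mm; apply; apply: mvs_le_refl; exact: Md.
Qed.

Lemma sublevel_ker m : M m -> level m = level e -> m = e.
Proof.
by move=> Mm me; apply/mvs_le_e => //; apply/sublevel_subset; rewrite ?me.
Qed.

(** Test the inclusion on a triple realizing [m + n]. *)
Lemma sublevel_comp_subset m n p : M m -> M n ->
  (level n \; level m)%relation `<=` level p <->
  le (add m n) p.
Proof.
move=> Mm Mn; split=> [|mnp]; last first.
  exact: subset_trans (sublevel_comp Mm Mn) (sublevel_mono mnp).
have [x [y [z [xy yz <-]]]] := sumsd Mm Mn.
move=> /(_ (x, z)); apply; exists y; rewrite /sublevel/= ?xy ?yz;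
  exact: mvs_le_refl.
Qed.

(** The intersection defining the sum of two entourages is attained at
    [level (m + n)], the least level set containing the composition. *)
Lemma entourage_add_sublevel m n : M m -> M n ->
  entourage_add (level @` M) (level m) (level n) =
  level (add m n).
Proof.
move=> Mm Mn; apply/seteqP; split=> [q|q qmn _ [[p Mp <-]]].
  apply; split; last exact: sublevel_comp.
  by exists (add m n) => //; exact: mvs_add.
by move=> /(sublevel_comp_subset _ Mm Mn) /sublevel_mono; apply.
Qed.

Lemma sublevel_setU :
  level @` (M `\ e) `|` [set level e] = level @` M.
Proof.
apply/seteqP; split=> U.
  by move=> [[m [Mm _] <-]|->]; [exists m | exists e => //; exact: mvs_e].
move=> [m Mm <-]; have [->|me] := EM (m = e); first by right.
by left; exists m.
Qed.

(** A level set contains [p] exactly when its value is at least that of [d] at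
    [p]. *)
Lemma least_entourage_sublevel p : (~` level e) p ->
  least_entourage (level e) (level @` (M `\ e)) p =
  level (d p.1 p.2).
Proof.
move=> pe; rewrite /least_entourage memNset//.
apply/seteqP; split=> [q|q qp _ [[m Mm <-] pm]]; last first.
  exact: mvs_le_trans qp pm.
apply; split; last by apply: mvs_le_refl; exact: Md.
exists (d p.1 p.2) => //; split; first exact: Md.
move=> pE; apply: pe; rewrite /sublevel/= pE; apply: mvs_le_refl; exact: mvs_e.
Qed.

Lemma sublevel_conditions :
  let U0 := level e in
  let Vs := level @` (M `\ e) in
  let V := Vs `|` [set U0] in
  let addV := entourage_add V in
  [/\ diagonal `<=` U0,
      is_qu_base (filter_from (M `\ e) level) Vs,
      (forall U, Vs U -> U0 `<=` U /\ U0 <> U) &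
      \bigcup_(U in Vs) U = setT] /\
  [/\ Vs = [set least_entourage U0 Vs p | p in ~` U0],
      is_mvs V addV U0,
      (forall A B, V A -> V B -> (mvs_le V addV A B <-> A `<=` B)) &
      atom_free V addV U0].
Proof.
move=> U0 Vs V addV.
have VE : V = level @` M by exact: sublevel_setU.
have Me := mvs_e.
have addVE m n : M m -> M n ->
    addV (level m) (level n) = level (add m n).
  by rewrite /addV VE; exact: entourage_add_sublevel.
have memU0 p : U0 p <-> d p.1 p.2 = e.
  split; first by move=> /mvs_le_e; apply; exact: Md.
  by rewrite /U0 /sublevel/= => ->; exact: mvs_le_refl.
split; split.
- exact: diagonal_sublevel.
- split=> [_ [m Mm <-]|U [m Mm mU]]; first exact: in_filter_from.
  by exists (level m) => //; exists m.
- move=> _ [m [Mm me] <-]; split.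
    by apply: sublevel_mono; exists m => //; exact: mvs_add0.
  by move=> /esym /(sublevel_ker Mm).
- apply/seteqP; split=> // p _.
  have [pe|pe] := EM (d p.1 p.2 = e); last first.
    exists (level (d p.1 p.2)); last by apply: mvs_le_refl; exact: Md.
    by exists (d p.1 p.2) => //; split.
  have [U [m [Mm me] mU]] := qu_nonempty sublevel_quasiuniformity.
  exists (level m); first by exists m.
  by rewrite /sublevel/= pe; exists m => //; exact: mvs_add0.
- apply/seteqP; split=> [_ [m [Mm me] <-]|_ [p pU0 <-]].
    have [p pm] := sublevel_onto Mm.
    have pU0 : (~` U0) p by move=> /memU0; rewrite pm => /me.
    by exists p => //; rewrite /U0 /Vs least_entourage_sublevel ?pm.
  rewrite /U0 /Vs least_entourage_sublevel//.
  by exists (d p.1 p.2) => //; split=> // /memU0.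
- by rewrite VE; apply: mvs_image addVE sublevel_ker.
- rewrite VE => _ _ [m Mm <-] [n Mn <-]; rewrite sublevel_subset//.
  split=> [[_ [c Mc <-]]|[c Mc <-]].
    rewrite addVE// => mcn.
    apply: (@mvs_le_trans _ (add m c)) => //; first exact: mvs_le_addr.
    by apply/sublevel_subset; rewrite ?mcn//; exact: mvs_add.
  by exists (level c); [exists c | rewrite addVE].
- by rewrite VE; apply: atom_free_image addVE sublevel_ker afM.
Qed.

End Sublevels.

(** * Realizing every sum *)

Section Hedgehog.
Context {Z : Type} (f : Z -> Z -> T).

Local Notation hedgehog := (hedgehog M Z).
Local Notation dist := (@hedgehog_dist T M add e Z f).

Hypotheses (afM : atom_free M add e) (qf : is_quasimetric M add e f).

Let addC := afM.1.
Let Mf x y : M (f x y). Proof. exact: (qm_val qf). Qed.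

Lemma hedgehog_distE p q : p <> q ->
  dist p q = add (add (sval p.1.2) (f p.1.1 q.1.1)) (sval q.1.2).
Proof. by move=> pq; rewrite /hedgehog_dist asboolF. Qed.

Lemma hedgehog_dist_refl p : dist p p = e.
Proof. by rewrite /hedgehog_dist asboolT. Qed.

(** When two of the three points coincide the triangle inequality is trivial.
    Otherwise the path through the middle tip is longer by twice the length of
    its spine. *)
Lemma hedgehog_quasimetric : is_quasimetric M add e dist.
Proof.
have Md p q : M (dist p q).
  rewrite /hedgehog_dist; case: ifP => _; first exact: mvs_e.
  by apply: mvs_add; [apply: mvs_add => //; exact: svalP | exact: svalP].
split=> //; first exact: hedgehog_dist_refl.
move=> p q r.
have [->|pq] := EM (p = q).
  by rewrite hedgehog_dist_refl mvs_add0//; exact: mvs_le_refl.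
have [->|qr] := EM (q = r).
  by rewrite hedgehog_dist_refl mvs_addr0//; exact: mvs_le_refl.
have [->|pr] := EM (p = r).
  rewrite hedgehog_dist_refl; exists (add (dist r q) (dist q r)).
    exact: mvs_add.
  by apply: mvs_add0; exact: mvs_add.
rewrite !hedgehog_distE//.
case: p q r {pq qr pr} => [[x [a Ma]] i] [[y [b Mb]] j] [[z [c Mc]] k] /=.
have MD := mvs_add; have assoc := mvs_assoc mvsM.
apply: (@mvs_le_trans _ (add (add a (f x y)) (add (f y z) c))).
- by apply: mvs_add => //; apply: mvs_add.
- have Mxy := Mf x y; have Myz := Mf y z.
  rewrite (assoc _ _ _ (MD _ _ Ma Mxy) Myz Mc) -(assoc _ _ _ Ma Mxy Myz).
  apply: (mvs_le_add addC (MD _ _ Ma (Mf x z)) Mc _ (mvs_le_refl Mc)).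
  exact: (mvs_le_add addC Ma (Mf x z) (mvs_le_refl Ma) (qm_triangle qf x y z)).
- apply: (mvs_le_add addC); [exact: MD | exact: MD | exact: mvs_le_addr | ].
  apply: (mvs_le_add addC _ Mc _ (mvs_le_refl Mc)) => //.
  exact: mvs_le_addl.
Qed.

(** The spines of length [e] at [x] have their tips at distance [e] from [x],
    and one of them serves as [x] itself; the Boolean is an arbitrary choice. *)
Definition hedgehog_base (x : Z) : hedgehog := (x, exist M e mvs_e, true).

Lemma hedgehog_dist_base x y :
  dist (hedgehog_base x) (hedgehog_base y) = f x y.
Proof.
have [xy|xy] := EM (x = y).
  by rewrite xy hedgehog_dist_refl (qm_refl qf).
rewrite hedgehog_distE; last by case.
by rewrite /= mvs_add0// mvs_addr0.
Qed.

(** Tips of lengths [m] and [n] on the two spines at [z]. Having two spines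
    keeps the tips distinct even for [m = n]. *)
Lemma hedgehog_realizes_sums : Z -> realizes_sums M add dist.
Proof.
move=> z m n Mm Mn; have Me := mvs_e.
exists (z, exist M m Mm, true), (hedgehog_base z), (z, exist M n Mn, false).
split.
- (* For [m = e] the first tip is the base point, at distance [e = m]. *)
  have [mb|ne] := EM ((z, exist M m Mm, true) = hedgehog_base z).
    rewrite mb hedgehog_dist_refl.
    by have := congr1 (fun p : hedgehog => sval p.1.2) mb.
  by rewrite hedgehog_distE//= (qm_refl qf) !mvs_addr0.
- by rewrite hedgehog_distE//= (qm_refl qf) !mvs_add0.
- by rewrite hedgehog_distE//= (qm_refl qf) mvs_addr0.
Qed.

End Hedgehog.
End MetricValueSet.

(** * Quasiuniform spaces and embeddings *)

Section QuasiuniformSpace.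
Context {Y : choiceType} {E : set (set (Y * Y))}.
Hypothesis quE : is_quasiuniformity E.

(** A copy of [Y] on which the topology induced by [E] can be the canonical
    one. *)
Definition quasiuniform_space of is_quasiuniformity E : Type := Y.
Local Notation QY := (quasiuniform_space quE).

HB.instance Definition _ := Choice.on QY.
HB.instance Definition _ :=
  hasNbhs.Build QY (fun x : Y => filter_from E (fun U => xsection U x)).

Let nbhs_filter (x : QY) : ProperFilter (nbhs x).
Proof.
apply: filter_from_proper.
  apply: filter_from_filter => [|U V EU EV]; first exact: qu_nonempty quE.
  exists (U `&` V); first exact: (qu_inter quE EU EV).
  by move=> y /xsectionP [xyU xyV]; split; apply/xsectionP.
by move=> U EU; exists x; apply/xsectionP; apply: (qu_diag quE EU).
Qed.

Let nbhs_singleton (x : QY) (A : set QY) : nbhs x A -> A x.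
Proof.
by case=> U EU; apply; apply/xsectionP; apply: (qu_diag quE EU).
Qed.

Let nbhs_nbhs (x : QY) (A : set QY) : nbhs x A -> nbhs x (nbhs^~ A).
Proof.
case=> U EU UA; have [V EV VU] := qu_split quE EU.
exists V => // y /xsectionP xy; exists V => // z /xsectionP yz.
by apply: UA; apply/xsectionP; apply: VU; exists y.
Qed.

HB.instance Definition _ :=
  Nbhs_isNbhsTopological.Build QY nbhs_filter nbhs_singleton nbhs_nbhs.

Lemma quasiuniform_space_induced :
  @induced_by_quasiuniformity QY E.
Proof. by []. Qed.

End QuasiuniformSpace.

(** The pointwise form of an embedding, in which the neighbourhoods of [x] are
    the traces of those of [f x]. *)
Lemma topological_embeddingP {X Y : topologicalType} (f : X -> Y) :
  topological_embedding f <->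
  injective f /\
  forall x, nbhs x = filter_from (nbhs (f x)) (fun B => f @^-1` B).
Proof.
split=> [[injf ctsf openf]|[injf nbhsf]].
  split=> // x; apply/seteqP; split=> A.
    rewrite nbhsE => -[O [openO Ox] OA].
    have /open_subspaceP[V openV VO] := openf _ openO.
    have VxE y : V (f y) <-> O y.
      have : (V `&` range f) (f y) <-> (f @` O `&` range f) (f y) by rewrite VO.
      move=> h; split=> [Vy|Oy].
        by have [|[z Oz /injf <-]] := h.1; first by split=> //; exists y.
      by have [] : (V `&` range f) (f y) by apply: h.2; split; exists y => //.
    exists V; first by apply: open_nbhs_nbhs; split=> //; apply/VxE.
    by move=> y /VxE /OA.
  move=> [B fxB BA]; have : nbhs x (f @^-1` B) by exact: ctsf.
  exact: filterS.
split=> //.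
  by move=> x A fA; rewrite nbhs_simpl/= nbhsf; exists A.
move=> O openO; apply/open_subspaceP.
(* The largest open set whose trace on [range f] lies in the image of [O]. *)
exists (f @` O `|` ~` range f)°; first exact: open_interior.
apply/seteqP; split=> y [yO yf]; split=> //.
  by have [//|] := interior_subset yO.
have [x Ox <-] := yO; have : nbhs x O by apply: open_nbhs_nbhs.
rewrite nbhsf => -[B xB BO]; apply: filterS xB => z Bz.
have [[w _ wz]|] := EM (range f z); last by right.
by left; exists w => //; apply: BO; rewrite /preimage/= wz.
Qed.

(** * The two implications *)

Definition embeds_in_quasiuniform (X : topologicalType) : Prop :=
  exists (Y : topologicalType) (E : set (set (Y * Y))) (f : X -> Y),
      [/\ is_quasiuniformity E,
          induced_by_quasiuniformity E,
          topological_embedding f &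
          exists (U0 : set (Y * Y)) (Vs : set (set (Y * Y))),
            let V := Vs `|` [set U0] in
            let addV := entourage_add V in
            [/\ diagonal `<=` U0,
                is_qu_base E Vs,
                (forall U, Vs U -> U0 `<=` U /\ U0 <> U) &
                \bigcup_(U in Vs) U = setT] /\
            [/\ Vs = [set least_entourage U0 Vs p | p in ~` U0],
                is_mvs V addV U0,
                (forall A B, V A -> V B ->
                  (mvs_le V addV A B <-> A `<=` B)) &
                atom_free V addV U0]].

(** The quasimetric lives on an auxiliary space [Z] with a point, as the
    hedgehog of an empty space is empty and realizes no sum. *)
Lemma quasimetric_embeds (X : topologicalType) (T : Type) (M : set T) add e
    (Z : Type) (z : Z) (f : Z -> Z -> T) (g : X -> Z) :
  is_mvs M add e -> atom_free M add e -> is_quasimetric M add e f ->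
  injective g ->
  (forall x, nbhs x = filter_from (M `\ e)
     (fun m => g @^-1` xsection (sublevel M add f m) (g x))) ->
  embeds_in_quasiuniform X.
Proof.
move=> mvsM afM qf injg nbhsg.
set Y : choiceType := {classic (hedgehog M Z)}.
pose d : Y -> Y -> T := hedgehog_dist add e f.
have qd : is_quasimetric M add e d by exact: hedgehog_quasimetric.
have quE := sublevel_quasiuniformity mvsM afM qd.
exists (quasiuniform_space quE), (filter_from (M `\ e) (sublevel M add d)).
exists (fun x => hedgehog_base mvsM (g x)).
split; [exact: quE | exact: quasiuniform_space_induced | | ]; last first.
  exists (sublevel M add d e).
  exists (sublevel M add d @` (M `\ e)).
  by apply: sublevel_conditions => //; exact: hedgehog_realizes_sums.
apply/topological_embeddingP; split=> [x y [/injg//]|x].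
rewrite nbhsg; apply/seteqP; split=> A.
- move=> [m Mm mA].
  exists (xsection (sublevel M add d m) (hedgehog_base mvsM (g x))).
    by exists (sublevel M add d m) => //; exact: in_filter_from.
  move=> y /xsectionP; rewrite /sublevel/= /d hedgehog_dist_base// => xy.
  by apply: mA; apply/xsectionP.
- move=> [B [U [m Mm mU] UB] BA]; exists m => // y /xsectionP xy; apply: BA.
  apply: UB; apply/xsectionP; apply: mU.
  by rewrite /sublevel/= /d hedgehog_dist_base.
Qed.

Lemma metrizable_embeds (X : topologicalType) (T : Type) (M : set T) add e :
  is_mvs M add e -> atom_free M add e -> mvs_metrizable X M add e ->
  embeds_in_quasiuniform X.
Proof.
move=> mvsM afM [f qf indf].
have [[x0 _]|X0] := EM (exists x : X, True); last first.
  (* An empty space embeds in the hedgehog of a single point. *)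
  apply: (@quasimetric_embeds X T M add e unit tt (fun _ _ => e) (fun=> tt));
    rewrite //.
  - split=> //; first by move=> _ _; exact: mvs_e mvsM.
    move=> _ _ _; rewrite (mvs_add0 mvsM (mvs_e mvsM)).
    exact: mvs_le_refl mvsM _ (mvs_e mvsM).
  - by move=> x; case: X0; exists x.
  - by move=> x; case: X0; exists x.
apply: (@quasimetric_embeds X T M add e X x0 f id) => // x.
by have [_ ->] := indf x; rewrite filter_from_qball.
Qed.

(** The values are the entourages themselves. Everything rests on
    [W p <-> u p <= W] for [W] in the family, where [u p] is the least
    entourage of [p]: it turns membership in an entourage into the order of
    the MVS, both for the triangle inequality and for the balls. *)
Lemma embeds_metrizable (X : topologicalType) :
  embeds_in_quasiuniform X ->
  exists (T : Type) (M : set T) (add : T -> T -> T) (e : T),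
    [/\ is_mvs M add e, atom_free M add e & mvs_metrizable X M add e].
Proof.
move=> [Y [E [g [quE indE /topological_embeddingP[injg nbhsg]]]]].
move=> [U0 [Vs]] /=; set V := Vs `|` [set U0]; set addV := entourage_add V.
move=> [[diagU0 [VsE baseVs] U0Vs _] [VsQ1 mvsV leV afV]].
exists _, V, addV, U0; split=> //.
pose u p := least_entourage U0 Vs p.
have Vu p : V (u p).
  have [pU0|pU0] := EM (U0 p).
    by right; rewrite /u /least_entourage mem_set.
  by left; rewrite VsQ1; exists p.
have uP p W : V W -> W p <-> u p `<=` W.
  move=> VW; rewrite /u /least_entourage; split.
    case: ifPn => [_ Wp|/negP pU0 Wp].
      case: VW => [/U0Vs[]//|->]; exact: subset_refl.
    case: VW => [VsW|WU0]; first by move=> q; apply.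
    by case: pU0; rewrite -WU0; exact: mem_set.
  by case: ifPn => [/set_mem pU0|_]; apply=> // U [].
pose d x y := u (g x, g y).
have qd : is_quasimetric V addV U0 d.
  split=> [x y|x|x y z]; first exact: Vu.
    by rewrite /d /u /least_entourage mem_set//; apply: diagU0.
  have VD : V (addV (d x y) (d y z)) by apply: (mvs_closed mvsV); exact: Vu.
  apply/leV => //; first exact: Vu.
  apply/uP => // W [_ compW]; apply: compW; exists (g y) => /=.
    by apply/uP; [exact: Vu | exact: subset_refl].
  by apply/uP; [exact: Vu | exact: subset_refl].
have VsV : V `\ U0 = Vs.
  apply/seteqP; split=> U; first by move=> [[]].
  by move=> VsU; split; [left | move=> /= UU0; have [_ []] := U0Vs _ VsU].
exists d => //; apply: induced_by_quasimetric_nbhs => // x.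
rewrite filter_from_qball// VsV nbhsg indE; apply/seteqP; split=> A.
- move=> [B [U /baseVs[W VsW WU] UB] BA]; exists W => // y /xsectionP /leV Wy.
  apply: BA; apply: UB; apply/xsectionP; apply: WU; apply/uP; first by left.
  by apply: Wy; [exact: Vu | left].
- move=> [W VsW WA]; exists (xsection W (g x)).
    by exists W => //; exact: VsE.
  move=> y /xsectionP xyW; apply: WA; apply/xsectionP.
  have VW : V W by left.
  by apply/leV => //; [exact: Vu | apply/uP].
Qed.

Theorem mainTheorem5 (X : topologicalType) :
  (exists (T : Type) (M : set T) (add : T -> T -> T) (e : T),
      [/\ is_mvs M add e, atom_free M add e & mvs_metrizable X M add e])
  <->
  (exists (Y : topologicalType) (E : set (set (Y * Y))) (f : X -> Y),
      [/\ is_quasiuniformity E,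
          induced_by_quasiuniformity E,
          topological_embedding f &
          exists (U0 : set (Y * Y)) (Vs : set (set (Y * Y))),
            let V := Vs `|` [set U0] in
            let addV := entourage_add V in
            [/\ diagonal `<=` U0,
                is_qu_base E Vs,
                (forall U, Vs U -> U0 `<=` U /\ U0 <> U) &
                \bigcup_(U in Vs) U = setT] /\
            [/\ (* Q1 *) Vs = [set least_entourage U0 Vs p | p in ~` U0],
                (* Q2 *) is_mvs V addV U0,
                (* Q3 *) (forall A B, V A -> V B ->
                            (mvs_le V addV A B <-> A `<=` B)) &
                (* Q4 *) atom_free V addV U0]]).
Proof.
split=> [[T [M [add [e [mvsM afM metX]]]]]|].
  exact: metrizable_embeds metX.
exact: embeds_metrizable.
Qed.
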